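(* Let $i\in\{0,\dots,n_{ini}-1\}$ be the index of an initial condition block and $j\ge 0$ the index of an upstream boundary condition block, and suppose that $N_{c_{ini}^i}(x_{n_{ini}},t')\ge N_{c_{up}^j}(x_{n_{ini}},t')$ for some time $t'>t_j+\frac{x_{n_{ini}}-x_0}{v_f}$. Then $$\forall t>t',\qquad N_{c_{ini}^i}(x_{n_{ini}},t)\ge N_{c_{up}^j}(x_{n_{ini}},t).$$
   Context: Fundamental diagram: $Q:[0,k_{jam}]\to[0,\infty)$ is a concave function with $Q(0)=Q(k_{jam})=0$. The free-flow speed is $v_f=Q'(0^+)>0$ and the congested wave speed is $w>0$ with $-w=Q'(k_{jam}^-)$ (both finite). The convex transform of $Q$ is $R(u)=\sup_{k\in[0,k_{jam}]}(Q(k)-uk)$ for $u\in[-w,v_f]$. The road link is the interval $[x_0,x_{n_{ini}}]$ with $x_0<x_1<\dots<x_{n_{ini}}$. For $i\in\{0,\dots,n_{ini}-1\}$ the $i$-th initial condition block, imposed at time $0$, is $c_{ini}^i(x)=-k_ix+b_i$ for $x_i\le x\le x_{i+1}$ and $+\infty$ otherwise. The blocks satisfy $0\le k_i\le k_{jam}$ and are continuous at their common endpoints: $c_{ini}^{i}(x_{i+1})=c_{ini}^{i+1}(x_{i+1})$. With $0=t_0<t_1<t_2<\dots$, the $j$-th upstream boundary condition block, imposed at $x=x_0$, is $c_{up}^j(t)=q_jt+d_j$ for $t_j\le t\le t_{j+1}$ and $+\infty$ otherwise. The flows satisfy $0\le q_j\le\max Q$ and consecutive blocks agree at their common endpoint.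 The solution components are given by the Lax-Hopf formula (infimum over the empty set equal to $+\infty$): for $x\in[x_0,x_{n_{ini}}]$ and $t>0$, $$N_{c_{ini}^i}(x,t)=\inf\{c_{ini}^i(y)+t\,R(\tfrac{x-y}{t}) : y\in[x_i,x_{i+1}],\ -w\le \tfrac{x-y}{t}\le v_f\},$$ and for $x\in(x_0,x_{n_{ini}}]$, $t>0$, $$N_{c_{up}^j}(x,t)=\inf\{c_{up}^j(s)+(t-s)R(\tfrac{x-x_0}{t-s}) : s\in[t_j,t_{j+1}],\ s<t,\ \tfrac{x-x_0}{t-s}\le v_f\}.$$ *)

(* Defs.v *)
(* MathComp-Analysis, over an arbitrary [R : realType]. *)
From HB Require Import structures.
From mathcomp Require Import all_boot all_order all_algebra.
From mathcomp Require Import all_classical all_reals all_analysis.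

Set Implicit Arguments.
Unset Strict Implicit.
Unset Printing Implicit Defensive.

Import Order.TTheory GRing.Theory Num.Theory.
Import numFieldNormedType.Exports.

Local Open Scope classical_set_scope.
Local Open Scope ring_scope.

(* The flow-density relation is only meaningful on `[0, kjam]; the values of
   [Q] elsewhere are unconstrained and never used. [Q'(0+)] and [Q'(kjam-)] are
   the one-sided derivatives, stated as limits of difference quotients. *)
Record fundamental_diagram (R : realType) (kjam vf w : R) (Q : R -> R) : Prop := {
  fd_kjam_gt0 : 0 < kjam;
  fd_ge0 : forall k : R, 0 <= k <= kjam -> 0 <= Q k;
  fd_concave : @convex_function R R^o `[0, kjam] (fun k => - Q k);
  fd_Q0 : Q 0 = 0;
  fd_Qkjam : Q kjam = 0;
  fd_vf_gt0 : 0 < vf;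
  fd_w_gt0 : 0 < w;
  fd_derive0 : (Q h - Q 0) / h @[h --> 0^'+] --> vf;
  fd_derive_kjam : (Q (kjam + h) - Q kjam) / h @[h --> 0^'-] --> - w }.

(* A fundamental diagram is continuous on the compact `[0, kjam], so that this
   supremum is attained: it is the maximum of [Q]. *)
Definition max_flow (R : realType) (kjam : R) (Q : R -> R) : R :=
  sup [set Q k | k in `[0, kjam]].

Definition convex_transform (R : realType) (kjam : R) (Q : R -> R) (u : R) : R :=
  sup [set Q k - u * k | k in `[0, kjam]].

Definition affine_block (R : realType) (lo hi slope cst : R) (z : R) : \bar R :=
  if lo <= z <= hi then (slope * z + cst)%:E else +oo%E.

Definition c_ini (R : realType) (x k b : nat -> R) (i : nat) : R -> \bar R :=
  affine_block (x i) (x i.+1) (- k i) (b i).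

Definition c_up (R : realType) (t q d : nat -> R) (j : nat) : R -> \bar R :=
  affine_block (t j) (t j.+1) (q j) (d j).

(* Only [x 0 .. x n], [k 0 .. k n.-1] and [b 0 .. b n.-1] are relevant. *)
Record initial_data (R : realType) (kjam : R) (n : nat) (x k b : nat -> R) :
    Prop := {
  ini_grid : forall i, (i < n)%N -> x i < x i.+1;
  ini_density : forall i, (i < n)%N -> 0 <= k i <= kjam;
  ini_continuous : forall i, (i.+1 < n)%N ->
    c_ini x k b i (x i.+1) = c_ini x k b i.+1 (x i.+1) }.

Record upstream_data (R : realType) (qmax : R) (t q d : nat -> R) : Prop := {
  up_t0 : t 0%N = 0;
  up_grid : forall j, t j < t j.+1;
  up_flow : forall j, 0 <= q j <= qmax;
  up_continuous : forall j,
    c_up t q d j (t j.+1) = c_up t q d j.+1 (t j.+1) }.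

(* Lax-Hopf solution components; [ereal_inf set0 = +oo]. [N_ini] is the solution
   for [x_0 <= xx <= x_n] and [0 < tt], [N_up] for [x_0 < xx <= x_n], [0 < tt]. *)
Definition N_ini (R : realType) (kjam vf w : R) (Q : R -> R)
    (x k b : nat -> R) (i : nat) (xx tt : R) : \bar R :=
  ereal_inf [set (c_ini x k b i y
                   + (tt * convex_transform kjam Q ((xx - y) / tt))%:E)%E
            | y in [set y | x i <= y <= x i.+1 /\ - w <= (xx - y) / tt <= vf]].

Definition N_up (R : realType) (kjam vf : R) (Q : R -> R) (x0 : R)
    (t q d : nat -> R) (j : nat) (xx tt : R) : \bar R :=
  ereal_inf [set (c_up t q d j s
                   + ((tt - s) * convex_transform kjam Q ((xx - x0) / (tt - s)))%:E)%E
            | s in [set s | [/\ t j <= s <= t j.+1, s < tt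
                              & (xx - x0) / (tt - s) <= vf]]].

(* Main.v *)
Require Import Defs.
From HB Require Import structures.
From mathcomp Require Import all_boot all_order all_algebra.
From mathcomp Require Import all_classical all_reals all_analysis.
From mathcomp Require Import lra.
Import Order.TTheory GRing.Theory Num.Theory.
Import numFieldNormedType.Exports.
Local Open Scope classical_set_scope.
Local Open Scope ring_scope.

(** A straight path that covers a distance [a] in a time [tau] costs
    [phi tau a = tau * R (a / tau) = sup_k (tau * Q k - a * k)], where [R] is
    the convex transform of [Q].  The derivative of [phi] in [tau] is the flow
    on the path; at nonnegative speed the density is on the free-flow branch,
    where the flow decreases as the speed [a / tau] increases.  Consider the
    paths that reach the exit [x n] at a time [T], and let [L] be the length of
    the link.  A path from the initial block takes the time [T] to cover at most
    [L], so its speed is at most [L / T]; a path that enters upstream at a time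
    [s >= 0] has speed [L / (T - s)], which is no smaller.  Hence, as [T] grows,
    the cost of every initial path grows at least as fast as that of every
    upstream path, and [N_ini - N_up] is nondecreasing at the exit.

    The comparison of growths is [path_cost_exchange].  It is proved without
    derivatives or maximizers, by exchanging densities between two paths, so
    concavity of [Q] only serves to make the suprema finite
    ([flow_le_double_midpoint]).  The lower bound on [t'] makes every point of
    the initial block able to reach the exit by the time [t'], so each initial
    path arriving later can be compared with the path from the same point that
    arrives at [t']; [N_up_growth] then passes from paths to the infimum. *)

(** Concavity at the midpoint of [k] and its mirror image [kjam - k], whose
    flow is nonnegative. *)
Lemma flow_le_double_midpoint {R : realType} {kjam vf w : R} {Q : R -> R} :
  fundamental_diagram kjam vf w Q ->
  forall {k}, 0 <= k <= kjam -> Q k <= 2 * Q (kjam / 2).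
Proof.
move=> hQ k hk.
have hk' : 0 <= kjam - k <= kjam by lra.
have half0 : 0 <= (2^-1 : R) by lra.
have half1 : (2^-1 : R) <= 1 by lra.
have := @fd_concave _ _ _ _ _ hQ (Itv01 half0 half1) k (kjam - k).
rewrite !inE /= !in_itv /= => /(_ hk hk').
rewrite convRE [X in - Q X <= _](_ : _ = kjam / 2) /= /unstable.onem; last first.
  by change (2^-1 * k + (1 - 2^-1) * (kjam - k) = kjam / 2); lra.
have := fd_ge0 hQ hk'.
by lra.
Qed.

Lemma path_cost_ge {R : realType} {kjam vf w : R} {Q : R -> R}
    (hQ : fundamental_diagram kjam vf w Q) (tau a k : R) :
  0 < tau -> 0 <= a -> 0 <= k <= kjam ->
  tau * Q k - a * k <= tau * convex_transform kjam Q (a / tau).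
Proof.
move=> tau0 a0 hk.
have -> : tau * Q k - a * k = tau * (Q k - a / tau * k).
  by rewrite mulrBr mulrA mulrCA divff ?mulr1 ?gt_eqF.
rewrite ler_pM2l//; apply: ub_le_sup; last first.
  by exists k => //=; rewrite in_itv.
exists (2 * Q (kjam / 2)) => _ [c /= hc <-].
rewrite in_itv /= in hc; have /andP[c0 _] := hc.
have u0 : 0 <= a / tau * c by rewrite !mulr_ge0// invr_ge0 ltW.
by have := flow_le_double_midpoint hQ hc; lra.
Qed.

Lemma path_cost_le {R : realType} {kjam : R} {Q : R -> R} (tau a M : R) :
  0 <= kjam -> 0 < tau ->
  (forall k, 0 <= k <= kjam -> tau * Q k - a * k <= M) ->
  tau * convex_transform kjam Q (a / tau) <= M.
Proof.
move=> kjam0 tau0 hM.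
rewrite mulrC -ler_pdivlMr//; apply: ge_sup.
  by exists (Q 0 - a / tau * 0), 0 => //=; rewrite in_itv /= lexx.
move=> _ [k /= hk <-]; rewrite in_itv /= in hk.
rewrite ler_pdivlMr//.
have -> : (Q k - a / tau * k) * tau = tau * Q k - a * k.
  by rewrite mulrBl mulrAC mulfVK ?gt_eqF// mulrC.
exact: hM.
Qed.

(** Delaying the arrival from [T'] to [T] costs a path that leaves at [0] and
    covers [a] at least as much as a path that leaves at [s] and covers [L].
    Given densities [k1] and [k2] for the two paths on the left, one of the
    pairs [(k1, k2)], [(k2, k1)], [(k1, k1)] does at least as well for the two
    paths on the right. *)
Lemma path_cost_exchange {R : realType} {kjam vf w : R} {Q : R -> R}
    (hQ : fundamental_diagram kjam vf w Q) {s T' T a L : R} :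
  0 <= s -> s < T' -> T' <= T -> 0 <= a <= L ->
  (T - s) * convex_transform kjam Q (L / (T - s))
    + T' * convex_transform kjam Q (a / T')
  <= T * convex_transform kjam Q (a / T)
    + (T' - s) * convex_transform kjam Q (L / (T' - s)).
Proof.
move=> s0 sT' T'T /andP[a0 aL].
have kjam0 := ltW (fd_kjam_gt0 hQ).
set M := (X in _ <= X).
rewrite -lerBrDr; apply: path_cost_le => //; first lra.
move=> k1 hk1; rewrite lerBrDl -lerBrDr; apply: path_cost_le => //; first lra.
move=> k2 hk2; rewrite lerBrDr /M.
have gT k : 0 <= k <= kjam ->
    T * Q k - a * k <= T * convex_transform kjam Q (a / T).
  by move=> hk; apply: (path_cost_ge hQ) => //; lra.
have gT' k : 0 <= k <= kjam -> (T' - s) * Q k - L * k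
    <= (T' - s) * convex_transform kjam Q (L / (T' - s)).
  by move=> hk; apply: (path_cost_ge hQ) => //; lra.
have [Q12|Q21] := leP (Q k1) (Q k2).
  have gain : 0 <= (T - T') * (Q k2 - Q k1) by apply: mulr_ge0; lra.
  by have := gT _ hk2; have := gT' _ hk1; nra.
have [k21|k12] := leP k2 k1.
  have gain_s : 0 <= s * (Q k1 - Q k2) by apply: mulr_ge0; lra.
  have gain_a : 0 <= (L - a) * (k1 - k2) by apply: mulr_ge0; lra.
  by have := gT _ hk1; have := gT' _ hk2; nra.
(* Here [k2] is congested: [k1] carries more flow at a lower density. *)
have gain_Q : 0 <= T' * (Q k1 - Q k2) by apply: mulr_ge0; lra.
have gain_a : 0 <= a * (k2 - k1) by apply: mulr_ge0; lra.
by have := gT _ hk1; have := gT' _ hk1; nra.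
Qed.

Lemma ini_grid_le {R : realType} {kjam : R} {n : nat} {x k b : nat -> R} :
  initial_data kjam n x k b ->
  forall {m p}, (m <= p)%N -> (p <= n)%N -> x m <= x p.
Proof.
move=> hini m; elim=> [|p IH]; first by rewrite leqn0 => /eqP ->.
rewrite leq_eqVlt => /predU1P[-> //|mp] pn.
by apply: le_trans (IH mp (ltnW pn)) _; exact: ltW (ini_grid hini pn).
Qed.

Lemma up_time_ge0 {R : realType} {qmax : R} {t q d : nat -> R} :
  upstream_data qmax t q d -> forall j, 0 <= t j.
Proof.
move=> hup; elim=> [|j IH]; first by rewrite (up_t0 hup).
exact: le_trans IH (ltW (up_grid hup j)).
Qed.

(** An entry time that is admissible for the arrival [T'] remains so for any
    later arrival [T], so a common bound on the growth of all the path costs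
    bounds the growth of their infimum. *)
Lemma N_up_growth (R : realType) (kjam vf : R) (Q : R -> R) (x0 xx : R)
    (t q d : nat -> R) (j : nat) (T' T g : R) :
  0 < vf -> T' <= T ->
  (forall s, t j <= s -> s < T' ->
     (T - s) * convex_transform kjam Q ((xx - x0) / (T - s))
     <= (T' - s) * convex_transform kjam Q ((xx - x0) / (T' - s)) + g) ->
  (N_up kjam vf Q x0 t q d j xx T
   <= N_up kjam vf Q x0 t q d j xx T' + g%:E)%E.
Proof.
move=> vf0 T'T hg.
rewrite -leeBlDr//; apply: le_ereal_inf_tmp => _ [s [ts sT' hv] <-].
have /andP[tjs _] := ts; rewrite leeBlDr//.
apply: ge_ereal_inf; eexists.
  exists s; last by reflexivity.
  split=> //; first exact: lt_le_trans T'T.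
  rewrite ler_pdivrMr; last lra.
  rewrite ler_pdivrMr in hv; last lra.
  by apply: le_trans hv _; rewrite ler_pM2l//; lra.
rewrite /c_up /affine_block ts -!EFinD lee_fin.
by have := hg s tjs sT'; lra.
Qed.

Theorem theorem2 (R : realType) (kjam vf w : R) (Q : R -> R)
    (n : nat) (x k b : nat -> R) (t q d : nat -> R)
    (hQ : fundamental_diagram kjam vf w Q)
    (hini : initial_data kjam n x k b)
    (hup : upstream_data (max_flow kjam Q) t q d)
    (i j : nat) (hi : (i < n)%N)
    (t' : R) (ht' : t j + (x n - x 0%N) / vf < t')
    (hN : (N_up kjam vf Q (x 0%N) t q d j (x n) t'
           <= N_ini kjam vf w Q x k b i (x n) t')%E) :
  forall s : R, t' < s ->
    (N_up kjam vf Q (x 0%N) t q d j (x n) s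
     <= N_ini kjam vf w Q x k b i (x n) s)%E.
Proof.
move=> T t'T.
have vf0 := fd_vf_gt0 hQ; have w0 := fd_w_gt0 hQ.
have tj0 := up_time_ge0 hup j.
apply: le_ereal_inf_tmp => _ [y [hy _] <-].
have /andP[xiy yxi1] := hy.
have x0xi : x 0%N <= x i := ini_grid_le hini (leq0n i) (ltnW hi).
have xi1xn : x i.+1 <= x n := ini_grid_le hini hi (leqnn n).
have travel0 : 0 <= (x n - x 0%N) / vf by rewrite divr_ge0//; lra.
have t'0 : 0 < t' by lra.
have reach : x n - x 0%N <= t' * vf by rewrite -ler_pdivrMr//; lra.
have y_adm : - w <= (x n - y) / t' <= vf.
  have ? : 0 <= (x n - y) / t' by rewrite divr_ge0//; lra.
  by rewrite ler_pdivrMr//; apply/andP; split; lra.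
pose c r := r * convex_transform kjam Q ((x n - y) / r).
(* The growth of the cost of the path from [y] bounds that of [N_up]. *)
have up_le : (N_up kjam vf Q (x 0%N) t q d j (x n) T
    <= N_up kjam vf Q (x 0%N) t q d j (x n) t' + (c T - c t')%:E)%E.
  apply: N_up_growth => //; first exact: ltW.
  move=> s tjs st'.
  have a_L : 0 <= x n - y <= x n - x 0%N by lra.
  have s0 : 0 <= s by lra.
  have := path_cost_exchange hQ s0 st' (ltW t'T) a_L.
  by rewrite -/(c T) -/(c t'); lra.
apply: le_trans up_le _.
have ini_le : (N_ini kjam vf w Q x k b i (x n) t'
    <= c_ini x k b i y + (c t')%:E)%E.
  by apply: ereal_inf_lbound; exists y.
apply: le_trans (leeD2r _ (le_trans hN ini_le)) _.
by rewrite /c_ini /affine_block hy -!EFinD lee_fin -/(c T); lra.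
Qed.
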